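(* Let $N$ be a square-free positive integer such that $\Gamma_0(N)^+$ has genus zero, and let $j_N$ be the Hauptmodul of $\Gamma_0(N)^+$, normalized so that its $q$-expansion has lead coefficient one, i.e. $j_N(z)=q^{-1}+\sum_{k\ge 0}c_kq^k$. Let $p_1<p_2$ be distinct primes which are relatively prime to $N$. If the coefficients of the $q$-expansion of $j_N$ are integers out to order $q^\kappa$ (that is, $c_k\in\mathbb{Z}$ for all $k\le\kappa$) for some $\kappa\ge \frac{p_2}{p_2-1}(p_1p_2)^2$, then all further coefficients in the $q$-expansion of $j_N$ are integers.
   Context: $\mathbb{H}$ is the upper half plane and $q=e^{2\pi i z}$. For a square-free positive integer $N$, $$\Gamma_0(N)^+=\left\{ e^{-1/2}\begin{pmatrix} a & b\\ c& d\end{pmatrix}\in \mathrm{SL}(2,\mathbb{R}):\ ad-bc=e,\ a,b,c,d,e\in\mathbb{Z},\ e\mid N,\ e\mid a,\ e\mid d,\ N\mid c\right\}$$ (with $e>0$). The surface $X_N=(\Gamma_0(N)^+/\{\pm \mathrm{Id}\})\backslash\mathbb{H}$ has exactly one cusp, at $i\infty$; the genus of $\Gamma_0(N)^+$ is that of the compactification of $X_N$. When this genus is zero, the Hauptmodul $j_N$ is the $\Gamma_0(N)^+$-invariant function, holomorphic on $\mathbb{H}$ with a simple pole at $i\infty$, which generates the field of meromorphic functions on the compactification of $X_N$ over $\mathbb{C}$. *)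

(* Defs.v *)
From HB Require Import structures.
From mathcomp Require Import all_boot all_order all_algebra.
From mathcomp Require Import generic_quotient.
From mathcomp Require Import all_classical all_reals all_analysis.
From mathcomp.real_closed Require Import complex.
Set Implicit Arguments.
Unset Strict Implicit.
Unset Printing Implicit Defensive.
Import Order.TTheory GRing.Theory Num.Theory.
Import numFieldNormedType.Exports.
Local Open Scope classical_set_scope.
Local Open Scope ring_scope.
Local Open Scope complex_scope.
Local Open Scope quotient_scope.

(* R[i] as a normed module over itself: [derivable f z 1] is then complex
   differentiability of f at z. *)
#[non_forgetful_inheritance]
HB.instance Definition _ (R : realType) :=
  NormedModule.copy R[i] ((R[i] : numFieldType)^o).

Definition squarefree (N : nat) : Prop :=
  (0 < N)%N /\ forall d : nat, (d ^ 2 %| N)%N -> d = 1%N.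

Section Genus.
Variable R : realType.

Definition simple_closed_curve (X : topologicalType) (g : R -> X) : Prop :=
  [/\ {within `[0, 1], continuous g}, g 0 = g 1 & {in `[0, 1[ &, injective g}].

Definition nonseparating_curves (X : topologicalType) (k : nat) : Prop :=
  exists g : 'I_k -> R -> X,
    [/\ forall i, simple_closed_curve (g i),
        forall i j, i != j -> (g i @` `[0, 1]) `&` (g j @` `[0, 1]) = set0
      & connected (~` \bigcup_(i in [set: 'I_k]) (g i @` `[0, 1]))].

(* The genus of a connected compact orientable surface X: the maximal number
   of pairwise disjoint simple closed curves along which X can be cut without
   becoming disconnected. *)
Definition has_genus (X : topologicalType) (n : nat) : Prop :=
  nonseparating_curves X n /\
  forall k, nonseparating_curves X k -> (k <= n)%N.

End Genus.

Section Modular.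
Variable R : realType.
Local Notation C := R[i].

Definition upper_half_plane : set C := [set z | 0 < complex.Im z].
Local Notation H := upper_half_plane.

Definition moebius (M : 'M[R]_2) (z : C) : C :=
  ((M 0 0)%:C * z + (M 0 1)%:C) / ((M 1 0)%:C * z + (M 1 1)%:C).

(* Membership in SL(2,R) need not be required: the determinant of
   e^(-1/2) A is (det A) / e. *)
Definition Gamma0_plus (N : nat) : set 'M[R]_2 :=
  [set M | exists (A : 'M[int]_2) (e : nat),
     [/\ (0 < e)%N, \det A = e%:Z, (e %| N)%N &
      [/\ (e%:Z %| A 0%R 0%R)%Z, (e%:Z %| A 1%R 1%R)%Z, (N%:Z %| A 1%R 0%R)%Z &
      M = (Num.sqrt e%:R)^-1 *: map_mx intr A]]].

Definition orbit (G : set 'M[R]_2) (z : H) : set H :=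
  [set w : H | exists2 M, G M & set_val w = moebius M (set_val z)].

(* When G is a group, two points are equivalent iff one lies in the orbit of
   the other; comparing the orbits themselves gives the same orbit space and
   is an equivalence relation for any set G. *)
Definition same_orbit (G : set 'M[R]_2) : rel H :=
  fun z w => `[< orbit G z = orbit G w >].

Lemma same_orbit_refl G : reflexive (same_orbit G).
Proof. by move=> z; apply/asboolP. Qed.

Lemma same_orbit_sym G : symmetric (same_orbit G).
Proof. by move=> z w; apply/asboolP/asboolP. Qed.

Lemma same_orbit_trans G : transitive (same_orbit G).
Proof. by move=> z w t /asboolP h /asboolP k; apply/asboolP; rewrite h. Qed.

Canonical same_orbit_equiv (G : set 'M[R]_2) : equiv_rel H :=
  EquivRel (same_orbit G) (@same_orbit_refl G) (@same_orbit_sym G)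
    (@same_orbit_trans G).

Definition orbit_space (G : set 'M[R]_2) : topologicalType :=
  quotient_topology {eq_quot same_orbit_equiv G}.

(* The surface X_N = Gamma_0(N)^+ \ H has a single cusp, so its
   compactification adds a single point, whose punctured neighbourhoods are
   the complements of compact sets. *)
Definition X0_plus (N : nat) : topologicalType :=
  one_point_compactification (orbit_space (Gamma0_plus N)).

Definition genus_zero (N : nat) : Prop := has_genus R (X0_plus N) 0.

(* q = exp(2 pi i z) *)
Definition nome (z : C) : C :=
  (expR (- (2 * pi * complex.Im z)))%:C
    * (cos (2 * pi * complex.Re z) +i* sin (2 * pi * complex.Re z)).

Definition holomorphic_near (z0 : C) (f : C -> C) : Prop :=
  \forall z \near z0, derivable f z 1.

Definition meromorphic_at (z0 : C) (f : C -> C) : Prop :=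
  exists (n : nat) (g : C -> C), holomorphic_near z0 g /\
    \forall z \near z0^', f z = g z / (z - z0) ^+ n.

Definition near_cusp (P : C -> Prop) : Prop :=
  exists Y : R, forall z, Y < complex.Im z -> P z.

(* The stabiliser of the cusp in Gamma_0(N)^+ is generated by -1 and
   z |-> z + 1, so nome is a local coordinate of the compactification there. *)
Definition meromorphic_at_cusp (f : C -> C) : Prop :=
  exists (n : nat) (g : C -> C), holomorphic_near 0 g /\
    near_cusp (fun z => f z = g (nome z) / nome z ^+ n).

Definition simple_pole_at_cusp (f : C -> C) : Prop :=
  exists g : C -> C, [/\ holomorphic_near 0 g, g 0 != 0 &
    near_cusp (fun z => f z = g (nome z) / nome z)].

Definition invariant_under (G : set 'M[R]_2) (f : C -> C) : Prop :=
  forall M z, G M -> H z -> f (moebius M z) = f z.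

(* Meromorphic functions on the compactification of X_N, pulled back to H.
   Values at poles are arbitrary subject to invariance; hence equality of
   such functions is equality on punctured neighbourhoods, as in
   [is_hauptmodul]. *)
Definition modular_function (N : nat) (f : C -> C) : Prop :=
  [/\ invariant_under (Gamma0_plus N) f,
      forall z, H z -> meromorphic_at z f & meromorphic_at_cusp f].

Definition is_hauptmodul (N : nat) (j : C -> C) : Prop :=
  [/\ invariant_under (Gamma0_plus N) j,
      forall z, H z -> derivable j z 1,
      simple_pole_at_cusp j &
      forall f, modular_function N f ->
        exists P Q : {poly C}, Q != 0 /\
          forall z0, H z0 -> \forall z \near z0^', f z = P.[j z] / Q.[j z]].

(* j(z) = q^(-1) + \sum_(k >= 0) c_k q^k for all z in H *)
Definition normalized_q_expansion (j : C -> C) (c : nat -> C) : Prop :=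
  forall z, H z ->
    series (fun k => c k * nome z ^+ k) @ \oo --> j z - (nome z)^-1.

Definition is_integer (x : C) : Prop := exists m : int, x = m%:~R.

End Modular.

(* Main.v *)
Require Import Defs.
From mathcomp Require Import all_boot all_order all_algebra.
From mathcomp Require Import all_classical all_reals all_analysis.
From mathcomp.real_closed Require Import complex.
From mathcomp Require Import ring lra zify.
Set Implicit Arguments.
Unset Strict Implicit.
Unset Printing Implicit Defensive.
Import Order.TTheory GRing.Theory Num.Theory.
Import numFieldNormedType.Exports.
Local Open Scope classical_set_scope.
Local Open Scope ring_scope.
Local Open Scope complex_scope.

(** Write u = q j = 1 + c_0 q + c_1 q^2 + ... The proof is an induction on the
    index: if k > kappa and the coefficients of index less than k are integers,
    so is c_k.

    For a prime p not dividing N, the Hecke transform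
      T_p f (z) = f (p z) + sum over b < p of f ((z + b) / p)
    preserves invariance under Gamma_0(N)^+, because right multiplication by an
    element of the group permutes the Hecke matrices up to left multiplication by
    elements of the group ([hecke_invariant]). Hence T_p (j^m) is invariant, with
    a pole of order p m at the cusp, and its polar part has integral coefficients.
    Subtracting integral multiples of powers of j one after the other removes the
    polar part and the constant term, and what is left is 0. So T_p (j^m) is a
    polynomial in j with integral coefficients, and its expansion is integral as
    far as that of j is ([integral_of_polar_part]).

    Compare the coefficients of q^n. In T_p (j^m) it is p times the coefficient
    of q^(p n) in j^m, up to a coefficient of smaller index; the former is m c_k
    plus an integer, where k = p n + m - 1. In the polynomial of degree p m in j
    only indices up to n + p m - 1 occur, which are smaller than k when n > m.
    Hence p m c_k is an integer ([hecke_integrality]). Two values of m that differ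
    by p show that p^2 c_k is an integer, and the two primes p1 and p2 together
    that c_k is one.

    That an invariant function with an expansion sum of a_k q^k, k >= 1, is 0 is
    the maximum principle on the compactified quotient ([qseries_vanish]). The
    group has one cusp: since N is square-free, every point is equivalent to one
    of height at least 1 / (5 N) ([atkin_lehner_reduction]). On that part of the
    half plane, a high power of the function is at most half of any bound for it,
    by Cauchy's estimate of the coefficients; so the bound halves indefinitely.
    All functions that occur are given by expansions convergent on the whole
    half plane, so Cauchy's estimate comes from averages over equidistant points
    of a horizontal line ([coef_average]) and not from contour integrals. *)

(** * The nome *)

Section Nome.
Variable R : realType.
Local Notation C := R[i].
Implicit Types z w : C.

Lemma nomeD z w : nome (z + w) = nome z * nome w.
Proof.
case: z w => [x y] [u v]; rewrite /nome /= !mulrDr !opprD expRD cosD sinD.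
by simpc; congr (_ +i* _); ring.
Qed.

Lemma nome0 : nome 0 = 1 :> C.
Proof. by rewrite /nome /= !mulr0 oppr0 expR0 cos0 sin0 mul1r. Qed.

Lemma nome1 : nome 1 = 1 :> C.
Proof.
rewrite /nome /= mulr0 mulr1 oppr0 expR0 mul1r mulr_natl cos2pi.
by rewrite sin_mulr2n sinpi mulr0 mul0rn.
Qed.

Lemma nome_natl (n : nat) z : nome (n%:R * z) = nome z ^+ n.
Proof.
elim: n => [|n IHn]; first by rewrite mul0r nome0.
by rewrite -natr1 mulrDl mul1r nomeD IHn exprSr.
Qed.

(** The radius of the circle onto which the nome maps the line Im z = y. *)
Definition radius (y : R) : R := expR (- (2 * pi * y)).

Lemma norm_nome z : `|nome z| = (radius (complex.Im z))%:C.
Proof.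
rewrite /nome normrM normc_def /= expr0n addr0 sqrtr_sqr (ger0_norm (expR_ge0 _)).
by rewrite normc_def /= cos2Dsin2 sqrtr1 mulr1.
Qed.

Lemma nome_neq0 z : nome z != 0.
Proof. by rewrite -normr_gt0 norm_nome ltcR expR_gt0. Qed.

Lemma radius_gt0 y : 0 < radius y. Proof. exact: expR_gt0. Qed.

Lemma radius_lt1 y : 0 < y -> radius y < 1.
Proof. by move=> y0; rewrite /radius expR_lt1 oppr_lt0 !mulr_gt0 // pi_gt0. Qed.

Lemma le_radius y y' : y <= y' -> radius y' <= radius y.
Proof. by move=> yy; rewrite ler_expR lerN2 ler_wpM2l // mulr_ge0 // pi_ge0. Qed.

Lemma radiusD y y' : radius (y + y') = radius y * radius y'.
Proof. by rewrite /radius mulrDr opprD expRD. Qed.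

(** By the double angle formula and the positivity of sine on ]0, pi[, cosine
    takes the value 1 only at multiples of 2 pi. *)
Lemma nome_frac_neq1 (n k : nat) : (0 < k < n)%N -> nome (k%:R / n%:R) != 1 :> C.
Proof.
move=> /andP[k0 kn]; have n0 : (0 < n)%N by apply: leq_ltn_trans kn.
have -> : k%:R / n%:R = (k%:R / n%:R : R)%:C :> C.
  by rewrite rmorphM fmorphV !rmorph_nat.
apply/eqP => /(congr1 (@complex.Re R)).
rewrite /nome /= mulr0 oppr0 expR0 mul1r mul0r subr0.
set x : R := k%:R / n%:R.
have -> : 2 * pi * x = (pi * x) *+ 2 by ring.
rewrite cos_mulr2n => h.
have s0 : 0 < sin (pi * x).
  have x0 : 0 < x by rewrite divr_gt0 ?ltr0n.
  have x1 : x < 1 by rewrite ltr_pdivrMr ?ltr0n // mul1r ltr_nat.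
  by apply: sin_gt0_pi; rewrite mulr_gt0 ?pi_gt0 //= gtr_pMr ?pi_gt0.
have := cos2Dsin2 (pi * x); have := exprn_gt0 2 s0; lra.
Qed.

(** Orthogonality of the characters of Z/n: a geometric sum whose ratio is an
    [n]-th root of unity. *)
Lemma sum_nome_frac (n k : nat) : (0 < n)%N ->
  \sum_(b < n) nome (b%:R / n%:R) ^+ k = (if (n %| k)%N then n%:R else 0) :> C.
Proof.
move=> n0; have nC : n%:R != 0 :> C by rewrite pnatr_eq0 -lt0n.
have nomeE (b : nat) : nome (b%:R / n%:R) ^+ k = nome (k%:R / n%:R) ^+ b :> C.
  by rewrite -!nome_natl; congr nome; ring.
under eq_bigr do rewrite nomeE.
case: ifPn => [/dvdnP[m ->]|ndvd].
  have -> : nome ((m * n)%:R / n%:R) = 1 :> C.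
    by rewrite natrM mulfK // -[m%:R]mulr1 nome_natl nome1 expr1n.
  by under eq_bigr do rewrite expr1n; rewrite sumr_const card_ord.
have neq1 : nome (k%:R / n%:R) != 1 :> C.
  have -> : nome (k%:R / n%:R) = nome ((k %% n)%:R / n%:R) :> C.
    rewrite {1}(divn_eq k n) natrD mulrDl nomeD natrM mulfK //.
    by rewrite -[X in nome X * _]mulr1 nome_natl nome1 expr1n mul1r.
  by apply: nome_frac_neq1; rewrite ltn_mod n0 lt0n -/(dvdn n k) ndvd.
have /eqP := subrX1 (nome (k%:R / n%:R) : C) n.
rewrite -nome_natl mulrCA divff // mulr1 -[k%:R]mulr1 nome_natl nome1 expr1n.
rewrite subrr eq_sym mulf_eq0 subr_eq0 mulr1 (negbTE neq1) /=.
by move/eqP.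
Qed.

End Nome.

(** * Convergent expansions in the nome *)

(** The coefficients of a product of two polynomials of degree less than [n]:
    those of index less than [n] do not see the truncation. *)
Lemma sum_mul_sum (K : comNzRingType) (u v : nat -> K) (n : nat) :
  (\sum_(i < n) u i) * (\sum_(i < n) v i) =
  \sum_(k < n) \sum_(i < k.+1) u i * v (k - i)%N +
  \sum_(n <= k < n + n) \sum_(i < k.+1)
    (if (i < n)%N then u i else 0) * (if (k - i < n)%N then v (k - i)%N else 0).
Proof.
pose P := \poly_(k < n) u k; pose Q := \poly_(k < n) v k.
have sPQ : (size (P * Q)%R <= n + n)%N.
  apply: leq_trans (size_polyMleq _ _) _; apply: leq_trans (leq_pred _) _.
  by rewrite leq_add // size_poly.
have -> : (\sum_(i < n) u i) * (\sum_(i < n) v i) = (P * Q).[1].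
  rewrite hornerM !horner_poly.
  by congr (_ * _); apply: eq_bigr => k _; rewrite expr1n mulr1.
have coefPQ k : (P * Q)`_k = \sum_(i < k.+1)
    (if (i < n)%N then u i else 0) * (if (k - i < n)%N then v (k - i)%N else 0).
  by rewrite coefM; apply: eq_bigr => i _; rewrite !coef_poly.
rewrite (horner_coef_wide _ sPQ) -(big_mkord xpredT (fun k => (P * Q)`_k * 1 ^+ k)).
rewrite (big_cat_nat (leq0n n) (leq_addr n n)) /= big_mkord; congr (_ + _).
  apply: eq_bigr => k _; rewrite expr1n mulr1 coefPQ; apply: eq_bigr => i _.
  by rewrite !(leq_ltn_trans _ (ltn_ord k)) ?leq_subr // -ltnS.
by apply: eq_bigr => k _; rewrite expr1n mulr1 coefPQ.
Qed.

Section QSeries.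
Variable R : realType.
Local Notation C := R[i].
Local Notation H := (@upper_half_plane R).
Implicit Types (f g : C -> C) (a b : nat -> C).

Lemma realCM (x y : R) : (x * y)%:C = x%:C * y%:C.
Proof. exact: rmorphM. Qed.

Lemma cvg_dist_le (u : nat -> C) (l x e : C) (n : nat) :
  u @ \oo --> l -> (forall m, (n <= m)%N -> `|u m - x| <= e) -> `|l - x| <= e.
Proof.
move=> ul ux; have e0 : 0 <= e by apply: le_trans (ux n _).
rewrite real_leNgt ?normr_real ?ger0_real //; apply/negP => lt_e.
move/cvgrPdist_lt: ul => /(_ (`|l - x| - e)); rewrite subr_gt0 => /(_ lt_e).
case=> N _ /(_ (maxn N n) (leq_maxl _ _)) /= lt_l.
have := ler_normD (l - u (maxn N n)) (u (maxn N n) - x).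
rewrite subrKA => /le_lt_trans /(_ (ltr_leD lt_l (ux _ (leq_maxr _ _)))).
by rewrite subrK ltxx.
Qed.

Lemma cvg_dist0 (u v : nat -> C) (l : C) (e : nat -> R) :
  v @ \oo --> l -> e @ \oo --> (0 : R) ->
  (forall n, `|u n - v n| <= (e n)%:C) -> u @ \oo --> l.
Proof.
move=> vl /cvgrPdist_lt e0 uv; apply/cvgrPdist_lt => eps eps0.
have [h epsE] : exists h : R, eps = h%:C.
  by apply/complex_realP; apply: gtr0_real.
have eps20 : 0 < eps / 2 by rewrite divr_gt0.
have h20 : 0 < h / 2 by rewrite divr_gt0 // -ltcR -epsE.
move/cvgrPdist_lt: vl => /(_ _ eps20) vl; near=> n.
have vn : `|l - v n| < eps / 2 by near: n.
have en : `|0 - e n| < h / 2 by near: n; apply: e0.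
rewrite sub0r normrN in en.
have -> : l - u n = (l - v n) - (u n - v n) by ring.
rewrite [eps]splitr; apply: le_lt_trans (ler_normB _ _) _.
apply: ltrD vn (le_lt_trans (uv n) _).
have -> : eps / 2 = (h / 2)%:C by rewrite epsE rmorphM fmorphV rmorph_nat.
by rewrite ltcR; apply: le_lt_trans en; apply: ler_norm.
Unshelve. all: by end_near.
Qed.

Lemma sum_geometric_le (x : R) (m n : nat) : 0 <= x < 1 ->
  \sum_(m <= k < n) x ^+ k <= x ^+ m / (1 - x).
Proof.
move=> /andP[x0 x1]; have d0 : 0 < 1 - x by rewrite subr_gt0.
rewrite ler_pdivlMr // mulrC big_distrr /=.
have [mn|nm] := leqP m n; last by rewrite big_geq ?exprn_ge0 // ltnW.
have -> : \sum_(m <= k < n) (1 - x) * x ^+ k = x ^+ m - x ^+ n.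
  have /= tel := telescope_sumr (fun k => x ^+ k) mn.
  by rewrite -[RHS]opprB -tel -sumrN; apply: eq_bigr => k _; rewrite exprS; ring.
by rewrite gerBl exprn_ge0.
Qed.

Lemma cvgCD (u v : nat -> C) (l m : C) :
  u @ \oo --> l -> v @ \oo --> m -> (fun n => u n + v n) @ \oo --> l + m.
Proof. exact: (@cvgD C C nat \oo _ u v l m). Qed.

Lemma cvgCM (u v : nat -> C) (l m : C) :
  u @ \oo --> l -> v @ \oo --> m -> (fun n => u n * v n) @ \oo --> l * m.
Proof. exact: (@cvgM C nat \oo _ u v l m). Qed.

Lemma cvgC_cst (x : C) : (fun _ : nat => x) @ \oo --> x.
Proof. exact: (@cvg_cst C x nat \oo _). Qed.

Lemma cvgC_shiftS (u : nat -> C) (l : C) :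
  (fun n => u n.+1) @ \oo --> l <-> u @ \oo --> l.
Proof. by have := @cvg_shiftS C u (nbhs l); rewrite /= => ->. Qed.

(** An expansion at the cusp that converges on the whole upper half plane.
    Pointwise convergence is stable under the operations below, and it implies
    bounds that are uniform on every half plane Im z >= y > 0. *)
Definition qseries a f := forall z, H z ->
  series (fun k => a k * nome z ^+ k) @ \oo --> f z.

Lemma ler_norm_exp_nome (z : C) y k : y <= complex.Im z ->
  `|nome z ^+ k| <= (radius y ^+ k)%:C.
Proof.
move=> yz; rewrite normrX norm_nome -rmorphXn lecR.
by rewrite lerXn2r ?nnegrE ?(ltW (radius_gt0 _)) ?le_radius.
Qed.

(** Convergence on the line Im z = y/2 makes the terms at height at least y
    decay geometrically. *)
Lemma qseries_term_le a f (y : R) : qseries a f -> 0 < y ->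
  exists2 B : R, 0 <= B & forall (z : C) k, y <= complex.Im z ->
    `|a k * nome z ^+ k| <= (B * radius (y / 2) ^+ k)%:C.
Proof.
move=> af y0; set w : C := 0 +i* (y / 2).
have Hw : H w by rewrite /upper_half_plane /= divr_gt0.
have : cvgn (fun k => a k * nome w ^+ k).
  apply/cvg_ex; exists (0 : C); apply: cvg_series_cvg_0.
  by apply/cvg_ex; eexists; exact: af.
move=> /cvg_seq_bounded [M [Mreal]] /(_ (`|M| + 1)).
have -> : M < `|M| + 1.
  by rewrite (le_lt_trans (real_ler_norm Mreal)) // ltrDl ltr01.
move=> /(_ isT) bnd.
have M0 : 0 <= `|M| + 1 by rewrite addr_ge0.
have [B BE] : exists B : R, `|M| + 1 = B%:C.
  by apply/complex_realP; apply: ger0_real.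
exists B; first by rewrite -ler0c -BE.
move=> z k yz; rewrite rmorphM.
apply: le_trans (_ : `|a k * nome w ^+ k| * (radius (y / 2) ^+ k)%:C <= _).
  rewrite !normrM -mulrA ler_wpM2l //.
  apply: le_trans (ler_norm_exp_nome k yz) _.
  rewrite normrX norm_nome /= -rmorphXn -rmorphM lecR -exprMn -radiusD.
  by rewrite -splitr.
apply: ler_wpM2r; first by rewrite ler0c exprn_ge0 // ltW // radius_gt0.
by have /= := bnd k I; rewrite BE.
Qed.

Lemma qseries_tail_le a f (y : R) : qseries a f -> 0 < y ->
  exists B : R, forall (z : C) n, y <= complex.Im z ->
    `|f z - \sum_(k < n) a k * nome z ^+ k| <= (B * radius (y / 2) ^+ n)%:C.
Proof.
move=> af y0; have [B B0 term_le] := qseries_term_le af y0.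
have r01 : 0 <= radius (y / 2) < 1 by rewrite ltW ?radius_gt0 // radius_lt1 // divr_gt0.
exists (B / (1 - radius (y / 2))) => z n yz.
apply: (@cvg_dist_le _ _ _ _ n (af z (lt_le_trans y0 yz))) => m nm.
rewrite seriesEnat /= -(big_mkord xpredT (fun k => a k * nome z ^+ k)).
rewrite (big_cat_nat (leq0n n) nm) //= addrAC subrr add0r.
apply: le_trans (ler_norm_sum _ _ _) _.
apply: le_trans (_ : \sum_(n <= k < m) (B * radius (y / 2) ^+ k)%:C <= _).
  by apply: ler_sum => k _; apply: term_le.
rewrite -rmorph_sum lecR -mulr_sumr -mulrA ler_wpM2l // [leRHS]mulrC.
exact: sum_geometric_le.
Qed.

Lemma qseries_ext a b f g : qseries a f -> a =1 b ->
  (forall z, H z -> f z = g z) -> qseries b g.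
Proof.
move=> af ab fg z Hz; rewrite -fg //.
have -> : b = a by apply/funext => k; rewrite ab.
exact: af.
Qed.

Lemma qseriesD a b f g : qseries a f -> qseries b g ->
  qseries (fun k => a k + b k) (fun z => f z + g z).
Proof.
move=> af bg z Hz; have h := cvgCD (af z Hz) (bg z Hz).
rewrite (_ : series _ = series (fun k => a k * nome z ^+ k)
  \+ series (fun k => b k * nome z ^+ k)); first exact: h.
apply/funext => n; rewrite /= !seriesEnat /= -big_split /=.
by apply: eq_bigr => k _; rewrite mulrDl.
Qed.

Lemma qseriesZ (x : C) a f : qseries a f ->
  qseries (fun k => x * a k) (fun z => x * f z).
Proof.
move=> af z Hz.
have h := cvgCM (@cvgC_cst x) (af z Hz).
rewrite (_ : series _ = cst x \* series (fun k => a k * nome z ^+ k)); first exact: h.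
apply/funext => n; rewrite /= !seriesEnat /= mulr_sumr.
by apply: eq_bigr => k _; rewrite mulrA.
Qed.

Lemma qseries_cons (x : C) a f : qseries a f ->
  qseries (fun k => if k is k'.+1 then a k' else x) (fun z => x + nome z * f z).
Proof.
move=> af z Hz.
have h := cvgCM (@cvgC_cst (nome z)) (af z Hz).
have {}h := cvgCD (@cvgC_cst x) h.
apply/cvgC_shiftS.
rewrite (_ : (fun n => series _ n.+1) = cst x \+ (cst (nome z) \*
  series (fun k => a k * nome z ^+ k))); first exact: h.
apply/funext => n; rewrite /= !seriesEnat /= big_nat_recl // expr0 mulr1 mulr_sumr.
by congr (_ + _); apply: eq_bigr => k _; rewrite exprS; ring.
Qed.

Lemma qseries_behead a f : qseries a f ->
  qseries (fun k => a k.+1) (fun z => (f z - a 0%N) / nome z).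
Proof.
move=> af z Hz; have {}af := (cvgC_shiftS _ _).2 (af z Hz).
have h := cvgCD af (@cvgC_cst (- a 0%N)).
have {}h := cvgCM h (@cvgC_cst (nome z)^-1).
rewrite (_ : series _ =
  (fun n => series (fun k => a k * nome z ^+ k) n.+1 - a 0%N) \* cst (nome z)^-1);
  first exact: h.
apply/funext => n; rewrite /= !seriesEnat /= big_nat_recl // expr0 mulr1.
rewrite addrAC subrr add0r mulr_suml; apply: eq_bigr => k _.
by rewrite exprSr mulrA mulfK // nome_neq0.
Qed.

Lemma qseries_cst (x : C) : qseries (fun k => if k is 0%N then x else 0) (cst x).
Proof.
move=> z Hz; apply/cvgC_shiftS.
rewrite (_ : (fun n => series _ n.+1) = cst x); first exact: cvgC_cst.
apply/funext => n; rewrite /= seriesEnat /= big_nat_recl // expr0 mulr1.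
by rewrite big1 ?addr0 // => k _; rewrite mul0r.
Qed.

Definition shift_coef (d : nat) a k := if (k < d)%N then 0 else a (k - d)%N.

Lemma qseries_shift d a f : qseries a f ->
  qseries (shift_coef d a) (fun z => nome z ^+ d * f z).
Proof.
elim: d => [|d IHd] af.
  by apply: (qseries_ext af) => [k|z _]; rewrite ?mul1r // /shift_coef ltn0 subn0.
apply: (qseries_ext (@qseries_cons 0 _ _ (IHd af))) => [[|k]|z _] //=.
by rewrite add0r exprS mulrA.
Qed.

Definition cauchy_prod a b n := \sum_(i < n.+1) a i * b (n - i)%N.

Lemma natr_exp_le (x : R) k : 0 <= x < 1 -> k.+1%:R * x ^+ k <= (1 - x)^-1.
Proof.
move=> x01; have := sum_geometric_le 0 k.+1 x01; rewrite expr0 mul1r.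
apply: le_trans; rewrite mulr_natl -[X in _ *+ X]subn0 -sumr_const_nat.
rewrite ler_sum_nat // => i /andP[_ ik].
by case/andP: x01 => x0 x1; apply: ler_wiXn2l => //; apply: ltW.
Qed.

(** By [sum_mul_sum], the product of two partial sums differs from the partial
    sum of the product by terms of degree at least [n]. The [k]-th of them is a
    sum of at most [k + 1] products of size [r ^+ k]; with [r = s * s], one factor
    [s ^+ k] absorbs [k + 1] and the other one tends to 0. *)
Lemma qseriesM a b f g : qseries a f -> qseries b g ->
  qseries (cauchy_prod a b) (fun z => f z * g z).
Proof.
move=> af bg z Hz; set y := complex.Im z; have y0 : 0 < y by [].
have [A A0 ale] := qseries_term_le af y0.
have [B B0 ble] := qseries_term_le bg y0.
set r := radius (y / 2) in ale ble.
set s := radius (y / 4).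
have rE : r = s * s by rewrite /r /s -radiusD; congr radius; field.
have s0 : 0 < s by apply: radius_gt0.
have s1 : s < 1 by rewrite radius_lt1 // divr_gt0.
have s01 : 0 <= s < 1 by rewrite ltW.
have r0 k : 0 <= r ^+ k by rewrite exprn_ge0 // rE mulr_ge0 // ltW.
pose K := A * B / (1 - s) / (1 - s).
apply: (cvg_dist0 (e := fun n => K * s ^+ n)) (cvgCM (af z Hz) (bg z Hz)) _ _.
  by apply: cvg_geometric; rewrite ger0_norm // ltW.
move=> n; rewrite !seriesEord /=.
rewrite (@sum_mul_sum C (fun k => a k * nome z ^+ k) (fun k => b k * nome z ^+ k)) /=.
have -> : \sum_(k < n) cauchy_prod a b k * nome z ^+ k =
    \sum_(k < n) \sum_(i < k.+1)
      a i * nome z ^+ i * (b (k - i)%N * nome z ^+ (k - i)).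
  apply: eq_bigr => k _; rewrite mulr_suml; apply: eq_bigr => i _.
  have -> : nome z ^+ k = nome z ^+ i * nome z ^+ (k - i).
    by rewrite -exprD subnKC // -ltnS.
  by ring.
rewrite opprD addrA subrr sub0r normrN; apply: le_trans (ler_norm_sum _ _ _) _.
apply: le_trans (_ : \sum_(n <= k < n + n) (A * B / (1 - s) * s ^+ k)%:C <= _);
  last first.
  rewrite -rmorph_sum lecR -mulr_sumr /K -[leRHS]mulrA ler_wpM2l //.
    by rewrite !mulr_ge0 // invr_ge0 subr_ge0 ltW.
  by rewrite [leRHS]mulrC; apply: sum_geometric_le.
apply: ler_sum => k _; apply: le_trans (ler_norm_sum _ _ _) _.
apply: le_trans (_ : \sum_(i < k.+1) (A * B * r ^+ k)%:C <= _).
  apply: ler_sum => i _; rewrite normrM.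
  have -> : A * B * r ^+ k = (A * r ^+ i) * (B * r ^+ (k - i)).
    have -> : r ^+ k = r ^+ i * r ^+ (k - i) by rewrite -exprD subnKC // -ltnS.
    by ring.
  rewrite rmorphM; apply: ler_pM => //.
    case: ifP => _; first exact: ale.
    by rewrite normr0 ler0c mulr_ge0.
  case: ifP => _; first exact: ble.
  by rewrite normr0 ler0c mulr_ge0.
rewrite sumr_const card_ord -rmorphMn lecR rE exprMn.
have -> : (A * B * (s ^+ k * s ^+ k)) *+ k.+1 = A * B * s ^+ k * (k.+1%:R * s ^+ k).
  by rewrite -mulr_natl; ring.
rewrite [leRHS]mulrAC ler_wpM2l ?natr_exp_le //.
by rewrite !mulr_ge0 // exprn_ge0 // ltW.
Qed.

End QSeries.

(** * Cauchy estimates and the maximum principle *)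

Section Vanishing.
Variable R : realType.
Local Notation C := R[i].
Local Notation H := (@upper_half_plane R).
Implicit Types (f g : C -> C) (a b : nat -> C).

Lemma le_of_le_add_geometric (x W B r : R) (n : nat) : 0 <= r < 1 ->
  (forall m, (n <= m)%N -> x <= W + B * r ^+ m) -> x <= W.
Proof.
move=> /andP[r0 r1] xle; rewrite leNgt; apply/negP => ltWx.
have : geometric B r @ \oo --> (0 : R) by apply: cvg_geometric; rewrite ger0_norm.
move/cvgrPdist_lt => /(_ (x - W)); rewrite subr_gt0 => /(_ ltWx)[N _].
move=> /(_ (maxn N n) (leq_maxl _ _)) /=; rewrite sub0r normrN => lt_geo.
have := xle _ (leq_maxr N n); rewrite -lerBlDl => /le_lt_trans.
by move=> /(_ _ (le_lt_trans (ler_norm _) lt_geo)); rewrite ltxx.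
Qed.

(** By orthogonality of the characters of Z/M: the degree is less than [M], so
    that each class modulo [M] contains a single index. *)
Lemma coef_average a (w : C) (M k : nat) : (k < M)%N ->
  \sum_(b < M) (\sum_(l < M) a l * nome (b%:R / M%:R + w) ^+ l)
    * nome (b%:R / M%:R) ^+ (M - k) = M%:R * (a k * nome w ^+ k).
Proof.
move=> kM; have M0 : (0 < M)%N by apply: leq_ltn_trans kM.
have inner (l : 'I_M) :
    \sum_(b < M) a l * nome (b%:R / M%:R + w) ^+ l * nome (b%:R / M%:R) ^+ (M - k)
    = if l == Ordinal kM then M%:R * (a k * nome w ^+ k) else 0.
  have -> : \sum_(b < M) a l * nome (b%:R / M%:R + w) ^+ l
      * nome (b%:R / M%:R) ^+ (M - k)
      = a l * nome w ^+ l * \sum_(b < M) nome (b%:R / M%:R : C) ^+ (l + (M - k)).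
    by rewrite mulr_sumr; apply: eq_bigr => b _; rewrite nomeD exprMn exprD; ring.
  rewrite sum_nome_frac //; have lM := ltn_ord l.
  have -> : (M %| l + (M - k))%N = (l == Ordinal kM).
    apply/idP/eqP => [/dvdnP[c cE]|->]; last by rewrite /= subnKC // ltnW.
    by apply: val_inj => /=; case: c cE => [|[|c]]; rewrite ?mulSn; lia.
  by case: eqP => [->|_]; rewrite ?mulr0 //= mulrC.
under eq_bigr do rewrite mulr_suml.
rewrite exchange_big /=; under eq_bigr do rewrite inner.
by rewrite -big_mkcond big_pred1_eq.
Qed.

(** [coef_average] bounds the coefficient by [W] plus the error of the truncation
    at degree [M], which disappears as [M] grows. *)
Lemma cauchy_estimate a f (W y : R) k : qseries a f -> 0 < y ->
  (forall z, H z -> `|f z| <= W%:C) -> `|a k| * (radius y ^+ k)%:C <= W%:C.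
Proof.
move=> af y0 fW; have [B tail] := qseries_tail_le af y0.
have r01 : 0 <= radius (y / 2) < 1.
  by rewrite ltW ?radius_gt0 // radius_lt1 // divr_gt0.
set w : C := 0 +i* y.
have -> : (radius y ^+ k)%:C = `|nome w ^+ k|.
  by rewrite normrX norm_nome -rmorphXn.
rewrite -normrM.
have [x xE] : exists x : R, `|a k * nome w ^+ k| = x%:C.
  by apply/complex_realP; apply: normr_real.
rewrite xE lecR; apply: (@le_of_le_add_geometric x W B _ k.+1 r01) => M kM.
have M0 : (0 < M)%N by apply: leq_ltn_trans kM.
rewrite -(@ler_pM2l _ M%:R) ?ltr0n // -lecR.
have -> : (M%:R * x)%:C = M%:R * `|a k * nome w ^+ k|.
  by rewrite rmorphM rmorph_nat xE.
rewrite -[M%:R in leLHS]normr_nat -normrM -coef_average //.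
apply: le_trans (ler_norm_sum _ _ _) _.
apply: le_trans (_ : \sum_(b < M) (W + B * radius (y / 2) ^+ M)%:C <= _); last first.
  by rewrite sumr_const card_ord -rmorphMn lecR mulr_natl.
apply: ler_sum => b _; rewrite normrM normrX.
have ImE : complex.Im (b%:R / M%:R + w) = y.
  have -> : b%:R / M%:R = (b%:R / M%:R : R)%:C :> C.
    by rewrite rmorphM fmorphV !rmorph_nat.
  by rewrite /= add0r.
have -> : `|nome (b%:R / M%:R : C)| = 1.
  have -> : b%:R / M%:R = (b%:R / M%:R : R)%:C :> C.
    by rewrite rmorphM fmorphV !rmorph_nat.
  by rewrite norm_nome /= /radius mulr0 oppr0 expR0.
rewrite expr1n mulr1 rmorphD.
set z := b%:R / M%:R + w.
have -> : \sum_(l < M) a l * nome z ^+ l = f z - (f z - \sum_(l < M) a l * nome z ^+ l).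
  by rewrite opprB addrC subrK.
apply: le_trans (ler_normB _ _) _; apply: lerD.
  by apply: fW; rewrite /upper_half_plane /= ImE.
by apply: tail; rewrite ImE.
Qed.

Lemma qseries_eq0 a f : qseries a f -> (forall z, H z -> f z = 0) -> forall k, a k = 0.
Proof.
move=> af f0 k.
have f_le0 z : H z -> `|f z| <= (0 : R)%:C by move=> Hz; rewrite f0 // normr0.
have := cauchy_estimate k af (@ltr01 R) f_le0.
rewrite pmulr_lle0 ?normr_le0 => [/eqP //|].
by rewrite ltcR exprn_gt0 // radius_gt0.
Qed.

Definition cauchy_exp a n :=
  iter n (cauchy_prod a) (fun k => if k is 0%N then 1 else 0).

Lemma qseriesX a f n : qseries a f -> qseries (cauchy_exp a n) (fun z => f z ^+ n).
Proof.
move=> af; elim: n => [|n IHn]; first exact: (@qseries_cst R 1).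
by apply: (qseries_ext (qseriesM af IHn)) => // z _; rewrite exprS.
Qed.

Lemma cauchy_exp_eq0 a n k : a 0%N = 0 -> (k < n)%N -> cauchy_exp a n k = 0.
Proof.
move=> a0; elim: n k => // n IHn k kn; apply: big1 => -[[|i] ik] _ /=.
  by rewrite a0 mul0r.
by rewrite [X in _ * X]IHn ?mulr0 //; lia.
Qed.

(** A Schwarz lemma: a bounded series vanishing to order [n] at the cusp is
    small near the cusp, by the estimate of its coefficients. *)
Lemma qseries_schwarz a f (W y : R) n : qseries a f -> 0 < y ->
  (forall z, H z -> `|f z| <= W%:C) -> (forall k, (k < n)%N -> a k = 0) ->
  forall z, y <= complex.Im z ->
    `|f z| <= (W * (radius (y / 2) ^+ n / (1 - radius (y / 2))))%:C.
Proof.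
move=> af y0 fW a0 z yz; set r := radius (y / 2).
have y20 : 0 < y / 2 by rewrite divr_gt0.
have r01 : 0 <= r < 1 by rewrite ltW ?radius_gt0 // radius_lt1.
have W0 : 0 <= W.
  by rewrite -ler0c; apply: le_trans (fW 'i _) => //; rewrite /upper_half_plane /=.
rewrite -[f z]subr0.
apply: (@cvg_dist_le _ _ _ _ _ n (af z (lt_le_trans y0 yz))) => m nm.
rewrite subr0 seriesEnat /= (big_cat_nat (leq0n n) nm) /=.
rewrite [X in X + _]big_nat big1 ?add0r; last first.
  by move=> k /andP[_ kn]; rewrite a0 ?mul0r.
apply: le_trans (ler_norm_sum _ _ _) _.
apply: le_trans (_ : \sum_(n <= k < m) (W * r ^+ k)%:C <= _); last first.
  by rewrite -rmorph_sum lecR -mulr_sumr ler_wpM2l // sum_geometric_le.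
apply: ler_sum => k _; rewrite normrM.
apply: le_trans (_ : `|a k| * (r ^+ k)%:C * (r ^+ k)%:C <= _).
  rewrite -mulrA ler_wpM2l // -rmorphM -exprMn -radiusD -splitr.
  exact: ler_norm_exp_nome.
rewrite realCM; apply: ler_wpM2r; last exact: (cauchy_estimate k af y20 fW).
by rewrite ler0c exprn_ge0 //; case/andP: r01.
Qed.

(** The maximum principle on the compactified quotient: [f] takes all its
    values at height at least [y], where a high power of [f] is at most half of
    any bound of that power on H, by [qseries_schwarz]. *)
Lemma qseries_vanish a f (y : R) : qseries a f -> a 0%N = 0 -> 0 < y ->
  (forall z, H z -> exists2 w, y <= complex.Im w & f w = f z) ->
  forall z, H z -> f z = 0.
Proof.
move=> af a0 y0 high; set r := radius (y / 2).
have y20 : 0 < y / 2 by rewrite divr_gt0.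
have /andP[r0 r1] : 0 <= r < 1 by rewrite ltW ?radius_gt0 // radius_lt1.
have [B tail] := qseries_tail_le af y0.
have fB z : H z -> `|f z| <= B%:C.
  move=> Hz; have [w yw <-] := high z Hz.
  by have := tail w 0%N yw; rewrite big_ord0 subr0 expr0 mulr1.
have [n rn] : exists n, r ^+ n / (1 - r) <= 2^-1.
  have : geometric (1 - r)^-1 r @ \oo --> (0 : R).
    by apply: cvg_geometric; rewrite ger0_norm.
  move/cvgrPdist_lt => /(_ 2^-1); rewrite invr_gt0 => /(_ (@ltr0n _ 2))[N _].
  move=> /(_ N (leqnn _)) /=; rewrite sub0r normrN => lt_geo; exists N.
  by rewrite mulrC; apply: le_trans (ler_norm _) (ltW lt_geo).
have gs := @qseriesX a f n af.
have halve (W : R) : (forall z, H z -> `|f z ^+ n| <= W%:C) ->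
    forall z, H z -> `|f z ^+ n| <= (W / 2)%:C.
  move=> gW z Hz; have [w yw <-] := high z Hz.
  have g0 k : (k < n)%N -> cauchy_exp a n k = 0 by apply: cauchy_exp_eq0.
  apply: le_trans (qseries_schwarz gs y0 gW g0 yw) _.
  rewrite lecR ler_wpM2l // -ler0c; apply: le_trans (gW _ Hz) => //.
have gBm m z : H z -> `|f z ^+ n| <= (B ^+ n * 2^-1 ^+ m)%:C.
  elim: m z => [|m IHm] z Hz.
    by rewrite mulr1 normrX rmorphXn lerXn2r ?nnegrE ?fB // (le_trans _ (fB z Hz)).
  by rewrite exprSr mulrA; apply: halve.
move=> z Hz.
have [x xE] : exists x : R, `|f z ^+ n| = x%:C.
  by apply/complex_realP; apply: normr_real.
have : x <= 0.
  apply: (@le_of_le_add_geometric x 0 (B ^+ n) 2^-1 0).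
    by rewrite invr_ge0 ler0n /= invf_lt1 // ltr1n.
  by move=> m _; rewrite add0r -lecR -xE; apply: gBm.
rewrite -lecR -xE normr_le0 expf_eq0 => /andP[_ /eqP //].
Qed.

End Vanishing.

(** * Integral representatives of the group *)

Section AtkinLehner.
Variable R : realType.
Local Notation C := R[i].
Local Notation H := (@upper_half_plane R).
Implicit Types (f g : C -> C) (z : C).

(** The quotient of (a, b; c, d) by the square root of [e] is an element of
    Gamma_0(N)^+, and it defines the same homography. *)
Definition atkin_lehner (N : nat) (a b c d : int) (e : nat) : Prop :=
  [/\ (0 < e)%N, a * d - b * c = e%:Z, (e %| N)%N &
    [/\ (e%:Z %| a)%Z, (e%:Z %| d)%Z & (N%:Z %| c)%Z]].

Definition homography (a b c d : int) z : C :=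
  (a%:~R * z + b%:~R) / (c%:~R * z + d%:~R).

Definition integral_invariant (N : nat) f := forall a b c d e z,
  atkin_lehner N a b c d e -> H z -> f (homography a b c d z) = f z.

Lemma intr_complex (m : int) : m%:~R = (m%:~R : R)%:C :> C.
Proof. by rewrite rmorph_int. Qed.

Lemma natr_complex (m : nat) : m%:R = (m%:R : R)%:C :> C.
Proof. by rewrite rmorph_nat. Qed.

Lemma invariant_under_integral N f :
  invariant_under (Gamma0_plus N) f -> integral_invariant N f.
Proof.
move=> finv a b c d e z [e0 det eN [ea ed Nc]] Hz.
pose A : 'M[int]_2 := \matrix_(i, j)
  if i == 0 then (if j == 0 then a else b) else (if j == 0 then c else d).
pose M : 'M[R]_2 := (Num.sqrt e%:R)^-1 *: map_mx intr A.
have GM : Gamma0_plus N M.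
  exists A, e; split=> //; first last.
    by rewrite !mxE.
  rewrite (expand_det_row _ ord0) !big_ord_recl big_ord0 /cofactor !det_mx11.
  by rewrite /A !mxE /= -det; ring.
rewrite -(finv M z GM Hz); congr f; rewrite /homography /moebius !mxE /=.
have s0 : ((Num.sqrt e%:R)^-1)%:C != 0 :> C.
  by rewrite fmorph_eq0 invr_eq0 sqrtr_eq0 -ltNge ltr0n.
rewrite !rmorphM /= -!intr_complex.
by rewrite -!mulrA -!mulrDr invfM mulrACA divff // mul1r.
Qed.

Lemma denom_neq0 (c d : int) z : H z -> (c, d) != (0, 0) -> c%:~R * z + d%:~R != 0 :> C.
Proof.
case: z => x y; rewrite /upper_half_plane /= => y0 cd.
rewrite !intr_complex; apply/eqP => h.
have /= := congr1 (@complex.Im R) h; rewrite mul0r addr0 addr0 => /eqP.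
rewrite mulf_eq0 (gt_eqF y0) orbF intr_eq0 => /eqP c0.
have /= := congr1 (@complex.Re R) h; rewrite c0 mulr0z !mul0r => d0.
have /eqP : d%:~R = 0 :> R by rewrite -d0; ring.
by rewrite intr_eq0 => /eqP d00; rewrite c0 d00 in cd.
Qed.

Lemma atkin_lehner_denom_neq0 N a b c d e z : atkin_lehner N a b c d e -> H z ->
  c%:~R * z + d%:~R != 0 :> C.
Proof.
move=> [e0 det _ _] Hz; apply: denom_neq0 => //.
by apply/eqP => -[c0 d0]; move: det e0; rewrite c0 d0 !mulr0 subr0; case: e.
Qed.

Lemma Im_homography (a b c d : int) z : H z -> (c, d) != (0, 0) ->
  complex.Im (homography a b c d z) = (a * d - b * c)%:~R * complex.Im z /
    ((c%:~R * complex.Re z + d%:~R) ^+ 2 + (c%:~R * complex.Im z) ^+ 2).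
Proof.
case: z => x y Hz cd.
have n0 : (c%:~R * x + d%:~R) ^+ 2 + (c%:~R * y) ^+ 2 != 0.
  have /negP nz := denom_neq0 Hz cd; apply/negP => /eqP h; apply: nz.
  rewrite -normr_eq0 -sqrf_eq0 -add_Re2_Im2 !intr_complex /=.
  by rewrite !(mul0r, addr0, subr0) h.
rewrite /homography invc_norm -add_Re2_Im2.
rewrite !intr_complex /= !(mul0r, addr0, subr0) rmorphB !rmorphM.
by field.
Qed.

End AtkinLehner.

(** * Reduction to heights bounded below *)

Section Reduction.
Variable R : realType.
Local Notation C := R[i].
Local Notation H := (@upper_half_plane R).
Implicit Types (f g : C -> C) (z : C).

(** Dirichlet's approximation theorem, by the pigeonhole principle: two of
    the [Q + 1] fractional parts of the multiples of [x] share one of [Q] boxes. *)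
Lemma dirichlet_approximation (x : R) (Q : nat) : (0 < Q)%N ->
  exists c d : int, [/\ 0 < c, c <= Q%:Z & `|c%:~R * x + d%:~R| <= Q%:R^-1].
Proof.
move=> Q0; have QR : 0 < Q%:R :> R by rewrite ltr0n.
pose fr (i : nat) : R := i%:R * x - (Num.floor (i%:R * x))%:~R.
have fr0 i : 0 <= fr i by rewrite subr_ge0 floor_le.
have fr1 i : fr i < 1.
  by rewrite ltrBlDr addrC; have := floorD1_gt (i%:R * x); rewrite intrD.
have Qfr0 i : 0 <= Q%:R * fr i by rewrite mulr_ge0 // ltW.
have box_lt (i : 'I_Q.+1) : (Num.truncn (Q%:R * fr i) < Q)%N.
  by rewrite truncn_lt_nat // gtr_pMr.
pose box i := Ordinal (box_lt i).
have : ~~ injectiveb box.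
  apply/negP => /injectiveP /leq_card; rewrite !card_ord ltnn //.
case/injectivePn => [i [j ij boxE]].
wlog lt_ij : i j ij boxE / (i < j)%N.
  move=> hw; have [||/val_inj ji] := ltngtP i j; first exact: hw.
    by apply: hw; rewrite 1?eq_sym.
  by rewrite ji eqxx in ij.
exists (j%:Z - i%:Z), (Num.floor (i%:R * x) - Num.floor (j%:R * x)); split.
- by rewrite subr_gt0 ltz_nat.
- by have := ltn_ord j; lia.
have -> : (j%:Z - i%:Z)%:~R * x + (Num.floor (i%:R * x) - Num.floor (j%:R * x))%:~R
    = fr j - fr i.
  by rewrite /fr !rmorphB /= -!pmulrn; ring.
rewrite -(ler_pM2l QR) divff ?gt_eqF // -[Q%:R in leLHS]gtr0_norm // -normrM mulrBr.
have /(congr1 val) /= tE := boxE.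
have /andP[i1 i2] := truncn_itv (Qfr0 i); have /andP[j1 j2] := truncn_itv (Qfr0 j).
rewrite -tE -natr1 in j1 j2; rewrite -natr1 in i2.
by rewrite ler_norml; apply/andP; split; lra.
Qed.

(** Dirichlet's theorem with [Q] of order [y^(-1/2)] makes both squares of order
    [y], and division by the greatest common divisor only shortens the vector. *)
Lemma exists_short_vector z : H z -> exists c d : int, coprimez c d /\
  (c%:~R * complex.Re z + d%:~R) ^+ 2 + (c%:~R * complex.Im z) ^+ 2
    <= 5 * complex.Im z.
Proof.
case: z => x y /= y0; rewrite /upper_half_plane /= in y0.
have [y1|y1] := leP 1 y.
  exists 0, 1; split=> //=; rewrite mulr0z !mul0r add0r; lra.
pose s := Num.sqrt y^-1; pose Q := (Num.truncn s).+1.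
have s2 : s ^+ 2 * y = 1 by rewrite sqr_sqrtr ?invr_ge0 ?mulVf ?gt_eqF // ltW.
have s0 : 0 < s by rewrite sqrtr_gt0 invr_gt0.
have sQ : s < Q%:R by apply: truncnS_gt.
have Qs : Q%:R <= s + 1 by rewrite /Q -natr1 lerD2r truncn_le ltW.
have s1 : 1 <= s by rewrite -sqrtr1 ler_wsqrtr // invf_ge1 // ltW.
have [c [d [c0 cQ cd]]] := @dirichlet_approximation x Q isT.
(* The first square is at most 1 / Q ^ 2 <= y, the second one at most
   (Q y) ^ 2 <= 4 y because Q <= 2 s. *)
have cd_le : (c%:~R * x + d%:~R) ^+ 2 + (c%:~R * y) ^+ 2 <= 5 * y.
  have QR : 0 < Q%:R :> R by rewrite ltr0n.
  have cR : c%:~R <= Q%:R :> R by rewrite -[Q%:R]/(Q%:Z%:~R) ler_int.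
  have cR0 : 0 <= c%:~R :> R by rewrite ler0z ltW.
  have h1 : (c%:~R * x + d%:~R) ^+ 2 <= y.
    rewrite -real_normK ?num_real //; apply: le_trans (_ : Q%:R^-1 ^+ 2 <= _).
      by rewrite lerXn2r ?nnegrE // invr_ge0 ltW.
    rewrite exprVn -[y]invrK lef_pV2 ?posrE ?exprn_gt0 ?invr_gt0 //.
    rewrite -[y^-1]sqr_sqrtr ?invr_ge0 ?(ltW y0) //.
    by rewrite lerXn2r ?nnegrE ?ltW.
  have h2 : (c%:~R * y) ^+ 2 <= 4 * y.
    have c2s : c%:~R <= 2 * s by lra.
    have -> : 4 * y = (2 * s * y) ^+ 2.
      have -> : (2 * s * y) ^+ 2 = 4 * (s ^+ 2 * y) * y by ring.
      by rewrite s2 mulr1.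
    rewrite lerXn2r ?nnegrE ?mulr_ge0 ?(ltW y0) ?(ltW s0) //.
    by rewrite ler_wpM2r // ltW.
  lra.
have [u [v uvE]] := Bezoutz c d.
have /dvdzP[c' cE] := dvdz_gcdl c d; have /dvdzP[d' dE] := dvdz_gcdr c d.
have g1 : 1 <= gcdz c d by rewrite /gcdz lez_nat gcdn_gt0 absz_gt0 (gt_eqF c0).
set g := gcdz c d in uvE cE dE g1.
exists c', d'; split.
  apply/coprimezP; exists (u, v) => /=.
  have g0 : g != 0 by rewrite gt_eqF // (lt_le_trans ltr01).
  by apply: (mulIf g0); rewrite mul1r mulrDl -!mulrA -cE -dE.
apply: le_trans cd_le; rewrite cE dE !rmorphM /=.
have gR : 1 <= g%:~R :> R by rewrite ler1z.
have -> : (c'%:~R * g%:~R * x + d'%:~R * g%:~R) ^+ 2 + (c'%:~R * g%:~R * y) ^+ 2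
  = g%:~R ^+ 2 * ((c'%:~R * x + d'%:~R) ^+ 2 + (c'%:~R * y) ^+ 2) :> R by ring.
by rewrite ler_peMl ?addr_ge0 ?sqr_ge0 // exprn_ege1.
Qed.

(** A common divisor of the cofactor [e] and of [c] divides [gcdn c N] as well, so
    that its square divides [N]. *)
Lemma squarefree_coprime N c : squarefree N -> coprime (N %/ gcdn c N) c.
Proof.
move=> [N0 sqf]; set g := gcdn c N; set e := (N %/ g)%N.
have NE : N = (e * g)%N by rewrite divnK // dvdn_gcdr.
set h := gcdn e c; have [he hc] : (h %| e)%N /\ (h %| c)%N.
  by rewrite dvdn_gcdl dvdn_gcdr.
apply/eqP/sqf; rewrite -mulnn NE dvdn_mul // dvdn_gcd hc.
by apply: dvdn_trans he _; rewrite NE dvdn_mulr.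
Qed.

(** Gamma_0(N)^+ has a single cusp: a coprime bottom row (c, d) extends, after
    scaling by [e = N / gcd(c, N)], to one of its elements, because [N] is
    squarefree; a short bottom row moves [z] to a point high enough. *)
Lemma atkin_lehner_reduction N z : squarefree N -> H z ->
  exists a b c d e, atkin_lehner N a b c d e /\
    (5 * N%:R)^-1 <= complex.Im (homography a b c d z).
Proof.
move=> sqf Hz; have [N0 _] := sqf.
have [c [d [cop cd_le]]] := exists_short_vector Hz.
set g := gcdn `|c| N; set e := (N %/ g)%N.
have NE : N = (g * e)%N by rewrite mulnC divnK // dvdn_gcdr.
have e0 : (0 < e)%N by move: N0; rewrite NE muln_gt0 => /andP[].
have eN : (e %| N)%N by rewrite NE dvdn_mull.
have cop2 : coprimez (d * e%:Z) c.
  rewrite coprimezMl [coprimez d c]coprimez_sym cop /=.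
  by rewrite coprimezE; apply: squarefree_coprime.
have /coprimezP[[a b] /= abE] := cop2.
have al : atkin_lehner N (a * e%:Z) (- b) (c * e%:Z) (d * e%:Z) e.
  split=> //; last split; try exact: dvdz_mull.
    by rewrite -[RHS]mul1r -abE; ring.
  rewrite NE PoszM dvdz_mul2r ?eqz_nat -?lt0n //.
  by rewrite dvdzE /= dvdn_gcdl.
exists (a * e%:Z), (- b), (c * e%:Z), (d * e%:Z), e; split=> //.
have cd0 : (c * e%:Z, d * e%:Z) != (0, 0).
  by apply/eqP => -[ce0 de0]; case: al e0 => _; rewrite ce0 de0; case: (e) => //; lia.
rewrite Im_homography //; have [_ -> _ _] := al.
have [eR NR] : 0 < e%:R :> R /\ 0 < N%:R :> R by rewrite !ltr0n.
have y0 : 0 < complex.Im z by [].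
have eN_le : e%:R <= N%:R :> R by rewrite ler_nat dvdn_leq.
set D := (c%:~R * complex.Re z + d%:~R) ^+ 2 + (c%:~R * complex.Im z) ^+ 2 in cd_le.
have -> : ((c * e%:Z)%:~R * complex.Re z + (d * e%:Z)%:~R) ^+ 2
    + ((c * e%:Z)%:~R * complex.Im z) ^+ 2 = e%:R ^+ 2 * D.
  by rewrite /D !rmorphM /= -!pmulrn; ring.
have D0 : 0 < D.
  rewrite lt0r addr_ge0 ?sqr_ge0 // andbT.
  rewrite paddr_eq0 ?sqr_ge0 // !sqrf_eq0 mulf_eq0 (gt_eqF y0) orbF.
  rewrite andbC; apply/negP => /andP[]; rewrite intr_eq0 => /eqP c0.
  rewrite c0 mulr0z mul0r add0r intr_eq0 => /eqP d0.
  by rewrite c0 d0 in cop.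
rewrite -pmulrn.
have -> : e%:R * complex.Im z / (e%:R ^+ 2 * D) = complex.Im z / (e%:R * D).
  by field; rewrite !gt_eqF.
rewrite -[leRHS]invf_div lef_pV2 ?posrE ?divr_gt0 ?mulr_gt0 // ler_pdivrMr //.
apply: le_trans (_ : N%:R * D <= _); first by rewrite ler_pM2r.
by rewrite [leRHS]mulrAC [leRHS]mulrC ler_pM2l.
Qed.

End Reduction.

(** * Invariance of the Hecke transform *)

Section HeckeInvariance.
Variable R : realType.
Local Notation C := R[i].
Local Notation H := (@upper_half_plane R).
Implicit Types (f g : C -> C) (z : C).

Definition hecke (p : nat) f z : C :=
  f (p%:R * z) + \sum_(b < p) f ((z + b%:R) / p%:R).

(** The matrices (p, 0; 0, 1) and (1, b; 0, p) of the Hecke operator, indexed by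
    the points of the projective line over Z/p that their rows generate. *)
Definition hecke_point p (x : option 'I_p) z : C :=
  if x is Some b then (z + b%:R) / p%:R else p%:R * z.

Definition line1 p (x : option 'I_p) : int := if x is Some _ then 1 else 0.
Definition line2 p (x : option 'I_p) : int := if x is Some b then b%:Z else 1.

Lemma heckeE p f z : hecke p f z = \sum_(x : option 'I_p) f (hecke_point x z).
Proof.
rewrite /hecke (bigD1 None) //=; congr (_ + _).
rewrite (reindex_omap Some id) /=; last by case.
by apply: eq_bigl => b; rewrite eqxx.
Qed.

Lemma solve_mod (p : nat) (s t : int) : prime p -> ~~ (p%:Z %| s)%Z ->
  exists b : 'I_p, (p%:Z %| s * b%:Z - t)%Z.
Proof.
move=> pp ps; have p0 : p%:Z != 0 by rewrite eqz_nat -lt0n prime_gt0.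
have /coprimezP[[u v] /= uv] : coprimez p s.
  by rewrite coprimezE /= prime_coprime.
have lt : (`|((v * t)%R %% p)%Z| < p)%N.
  by rewrite -ltz_nat gez0_abs ?modz_ge0 // ltz_pmod // ltz_nat prime_gt0.
exists (Ordinal lt); rewrite /= gez0_abs ?modz_ge0 //.
have -> : ((v * t)%R %% p)%Z = v * t - ((v * t)%R %/ p)%Z * p.
  by rewrite {2}(divz_eq (v * t) p); ring.
have -> : s * (v * t - ((v * t)%R %/ p)%Z * p) - t
    = - (u * t + s * ((v * t)%R %/ p)%Z) * p + (u * p + v * s - 1) * t by ring.
by rewrite uv subrr mul0r addr0 dvdz_mull.
Qed.

(** Right multiplication by A permutes the cosets represented by the Hecke
    matrices: D_x A = A' D_y, where the line [y] is the image of the line [x]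
    under A. That image is spanned by (0, 1) when [p] divides its first
    coordinate, and by (1, y) with [y] given by [solve_mod] otherwise. *)
Lemma hecke_point_homography N p (a b c d : int) (e : nat) (x : option 'I_p) :
  prime p -> coprime p N -> atkin_lehner N a b c d e ->
  exists y : option 'I_p,
    (p%:Z %| (line1 x * a + line2 x * c) * line2 y
             - (line1 x * b + line2 x * d) * line1 y)%Z /\
    exists a' b' c' d', atkin_lehner N a' b' c' d' e /\
      forall z, H z -> hecke_point x (homography a b c d z)
                       = homography a' b' c' d' (hecke_point y z).
Proof.
move=> pp pN al; have [e0 det eN [ea ed Nc]] := al.
have p0 : p%:R != 0 :> C by rewrite pnatr_eq0 -lt0n prime_gt0.
have pe : coprimez e p.
  by rewrite coprimezE /= coprime_sym (coprime_dvdr eN).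
have pN' : coprimez N p by rewrite coprimezE /= coprime_sym.
have ec : (e%:Z %| c)%Z by apply: dvdz_trans Nc; rewrite dvdzE.
have pZ : p%:Z != 0 by rewrite eqz_nat -lt0n prime_gt0.
have den z : H z -> c%:~R * z + d%:~R != 0 :> C := atkin_lehner_denom_neq0 al.
have pI : p%:Z%:~R = p%:R :> C by [].
case: x => [x|] /=; rewrite /homography ?mul1r ?mul0r ?add0r.
- have [/dvdzP[s sE]|ns] := boolP (p%:Z %| a + x%:Z * c)%Z.
    exists None => /=; rewrite mulr1 mulr0 subr0 sE dvdz_mull //; split=> //.
    exists s, (b + x%:Z * d), c, (p%:Z * d); split.
      split=> //; last split=> //; last by rewrite dvdz_mull.
        by rewrite -det mulrA -sE; ring.
      by rewrite -(Gauss_dvdzl _ pe) -sE rpredD ?dvdz_mull.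
    move=> z Hz; have sE' : s%:~R * p%:R = a%:~R + x%:R * c%:~R :> C.
      by rewrite -pI -rmorphM -sE rmorphD rmorphM.
    rewrite !rmorphD !rmorphM /= mulrA sE' -!pmulrn.
    have -> : c%:~R * (p%:R * z) + p%:R * d%:~R = p%:R * (c%:~R * z + d%:~R) :> C by ring.
    by field; rewrite p0 den.
  have [y /dvdzP[t tE]] := solve_mod (b + x%:Z * d) pp ns.
  exists (Some y) => /=; rewrite mulr1 tE dvdz_mull //; split=> //.
  exists (a + x%:Z * c), (- t), (p%:Z * c), (d - y%:Z * c); split.
    split=> //; last split; rewrite ?(rpredB, rpredD) ?dvdz_mull //.
    rewrite -det; transitivity (a * d - b * c + x%:Z * c * d + (b * c)
      - y%:Z * c * (a + x%:Z * c) + t * p%:Z * c).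
      by ring.
    by rewrite -tE; ring.
  move=> z Hz; have tE' : t%:~R * p%:R =
      (a%:~R + x%:R * c%:~R) * y%:R - (b%:~R + x%:R * d%:~R) :> C.
    by rewrite -pI -rmorphM -tE rmorphB rmorphM !rmorphD !rmorphM.
  have -> : (- t)%:~R =
      - ((a%:~R + x%:R * c%:~R) * y%:R - (b%:~R + x%:R * d%:~R)) / p%:R :> C.
    by rewrite -tE' rmorphN mulNr mulfK.
  rewrite !(rmorphD, rmorphN, rmorphM) /= -!pmulrn.
  have -> : p%:R * c%:~R * ((z + y%:R) / p%:R) + (d%:~R - y%:R * c%:~R)
      = c%:~R * z + d%:~R :> C.
    by field.
  by field; rewrite p0 den.
have [/dvdzP[s sE]|ns] := boolP (p%:Z %| c)%Z.
  exists None => /=; rewrite mulr1 mulr0 subr0 sE dvdz_mull //; split=> //.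
  exists a, (p%:Z * b), s, d; split.
    split=> //; last split=> //; last by rewrite -(Gauss_dvdzl _ pN') -sE.
    by rewrite -det sE; ring.
  move=> z Hz; have := den _ Hz; rewrite sE !rmorphM /= -!pmulrn => nz.
  by rewrite !mulrA ?[_ * p%:R]mulrC -?mulrDr; congr (_ / _); ring.
have [y /dvdzP[t tE]] := solve_mod d pp ns.
exists (Some y) => /=; rewrite mulr1 tE dvdz_mull //; split=> //.
exists (p%:Z * a), (b - a * y%:Z), c, (- t); split.
  split=> //; last split; rewrite ?dvdz_mull //.
    rewrite -det; transitivity (- (t * p%:Z) * a - (b - a * y%:Z) * c); first by ring.
    by rewrite -tE; ring.
  rewrite rpredN -(Gauss_dvdzl _ pe) -tE rpredB // mulrC dvdz_mull //.
move=> z Hz; have tE' : t%:~R * p%:R = c%:~R * y%:R - d%:~R :> C.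
  by rewrite -pI -rmorphM -tE rmorphB rmorphM.
have -> : (- t)%:~R = - (c%:~R * y%:R - d%:~R) / p%:R :> C.
  by rewrite -tE' rmorphN mulNr mulfK.
rewrite !(rmorphD, rmorphN, rmorphM) /= -!pmulrn.
have -> : c%:~R * ((z + y%:R) / p%:R) + - (c%:~R * y%:R - d%:~R) / p%:R =
   (c%:~R * z + d%:~R) / p%:R :> C by field.
by field; rewrite p0 den.
Qed.

(** A is invertible modulo [p], since its determinant [e] divides [N], which is
    prime to [p]. *)
Lemma line_image_inj N p (a b c d : int) (e : nat) (x x' y : option 'I_p) :
  prime p -> coprime p N -> atkin_lehner N a b c d e ->
  (p%:Z %| (line1 x * a + line2 x * c) * line2 y
           - (line1 x * b + line2 x * d) * line1 y)%Z ->
  (p%:Z %| (line1 x' * a + line2 x' * c) * line2 y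
           - (line1 x' * b + line2 x' * d) * line1 y)%Z -> x = x'.
Proof.
move=> pp pN [e0 det eN _] xy xy'.
have pe : coprimez p e by rewrite coprimezE /=; apply: coprime_dvdr pN.
have : (p%:Z %| line1 x * line2 x' - line1 x' * line2 x)%Z.
  rewrite -(Gauss_dvdzr _ pe) -det.
  move: xy xy'.
  set s := _ * a + _; set t := _ * b + _; set s' := _ * a + _; set t' := _ * b + _.
  move=> xy xy'.
  have -> : (a * d - b * c) * (line1 x * line2 x' - line1 x' * line2 x) = s * t' - s' * t.
    by rewrite /s /t /s' /t'; ring.
  case: y xy xy' => [y|] /=; rewrite ?mulr1 ?mulr0 ?subr0 => xy xy'.
    have -> : s * t' - s' * t = s' * (s * y%:Z - t) - s * (s' * y%:Z - t') by ring.
    by rewrite rpredB ?dvdz_mull.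
  by rewrite rpredB ?dvdz_mulr.
case: x {xy} => [x|]; case: x' {xy'} => [x'|] //=.
- rewrite !mul1r dvdzE /= => h; congr Some; apply/val_inj => /=.
  have [hx hx'] := (ltn_ord x, ltn_ord x').
  move: h; case: (leqP `|x'%:Z - x%:Z|%N 0) => [|n0 /(dvdn_leq n0)]; lia.
- by rewrite mul1r mul0r subr0 dvdzE /= dvdn1 => /eqP p1; rewrite p1 in pp.
- by rewrite mul1r mul0r sub0r dvdzE /= dvdn1 => /eqP p1; rewrite p1 in pp.
Qed.

Lemma hecke_invariant N p f : prime p -> coprime p N ->
  integral_invariant N f -> integral_invariant N (hecke p f).
Proof.
move=> pp pN finv a b c d e z al Hz; rewrite !heckeE.
have [s sP] := choice (fun x => @hecke_point_homography N p a b c d e x pp pN al).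
have s_inj : injective s.
  move=> x x' ss; have [xy _] := sP x; have [xy' _] := sP x'.
  by rewrite -ss in xy'; exact: line_image_inj pp pN al xy xy'.
rewrite [RHS](reindex_inj s_inj); apply: eq_bigr => x _.
have [_ [a' [b' [c' [d' [al' ->//]]]]]] := sP x.
apply: finv al' _; have p0 : 0 < p%:R :> R by rewrite ltr0n prime_gt0.
case: z Hz => u v; rewrite /upper_half_plane /= => v0.
case: (s x) => [y|] /=.
  rewrite !natr_complex -fmorphV /= mulr0 add0r addr0.
  by rewrite mulr_gt0 // invr_gt0.
by rewrite natr_complex /= mul0r addr0 mulr_gt0.
Qed.

End HeckeInvariance.

(** * Expansion of the Hecke transform *)

Section HeckeSeries.
Variable R : realType.
Local Notation C := R[i].
Local Notation H := (@upper_half_plane R).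
Implicit Types (f g : C -> C) (a b : nat -> C).

Lemma cvgC_comp (u : nat -> C) (l : C) (phi : nat -> nat) :
  (forall N, exists M, forall n, (M <= n)%N -> (N <= phi n)%N) ->
  u @ \oo --> l -> (fun n => u (phi n)) @ \oo --> l.
Proof.
move=> phi_oo /cvgrPdist_lt ul; apply/cvgrPdist_lt => e e0.
have [N _ uN] := ul e e0; have [M MP] := phi_oo N.
by exists M => // n /= Mn; apply: uN; apply: MP.
Qed.

Lemma cvgC_sum (p : nat) (u : 'I_p -> nat -> C) (l : 'I_p -> C) :
  (forall i, u i @ \oo --> l i) ->
  (fun n => \sum_i u i n) @ \oo --> \sum_i l i.
Proof.
elim: p u l => [|p IHp] u l ul.
  rewrite big_ord0 (_ : (fun _ => _) = fun=> 0); first exact: cvgC_cst.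
  by apply/funext => n; rewrite big_ord0.
rewrite big_ord_recr /=.
have := cvgCD (IHp _ _ (fun i => ul (widen_ord (leqnSn p) i))) (ul ord_max).
rewrite (_ : (fun n => \sum_i u i n) =
  (fun n => \sum_(i < p) u (widen_ord (leqnSn p) i) n + u ord_max n)) //.
by apply/funext => n; rewrite big_ord_recr.
Qed.

Lemma sum_dvdn (V : nmodType) (F : nat -> V) (p n : nat) : (0 < p)%N ->
  \sum_(l < n | (p %| l)%N) F l = \sum_(k < (n + p.-1) %/ p) F (k * p)%N.
Proof.
move=> p0; have divp x : ((x + p) %/ p = (x %/ p).+1)%N.
  by rewrite divnDr ?dvdnn // divnn p0 addn1.
elim: n => [|n IHn].
  by rewrite add0n divn_small ?prednK // !big_ord0.
rewrite big_mkcond big_ord_recr -big_mkcond /= IHn.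
have -> : (n.+1 + p.-1 = n + p)%N by rewrite addSnnS prednK.
rewrite divp; case: ifPn => [/dvdnP[c ->]|np].
  by rewrite divnMDl // divn_small ?prednK // addn0 mulnK // big_ord_recr.
have r0 : (0 < n %% p)%N by rewrite lt0n.
have -> : ((n + p.-1) %/ p = (n %/ p).+1)%N.
  rewrite {1}(divn_eq n p) -addnA divnMDl //.
  have -> : (n %% p + p.-1 = (n %% p).-1 + p)%N by lia.
  have lt_p : ((n %% p).-1 < p)%N.
    by apply: leq_ltn_trans (leq_pred _) _; rewrite ltn_mod.
  by rewrite divp (divn_small lt_p) addn1.
by rewrite addr0.
Qed.

(** The coefficients of q^(p m) T_p f, given those [a] of q^m f. In the sum over
    (z + b) / p, the factor q^(p m) is the power p^2 m of the nome of that point,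
    whence a shift by p^2 m - m before every [p]-th coefficient is kept. *)
Definition hecke_coef (p m : nat) a l : C :=
  (if (p %| l)%N then a (l %/ p)%N else 0)
  + p%:R * shift_coef ((p * p - 1) * m) a (p * l)%N.

Lemma qseries_scale p a g : (0 < p)%N -> qseries a g ->
  qseries (fun l => if (p %| l)%N then a (l %/ p)%N else 0) (fun z => g (p%:R * z)).
Proof.
move=> p0 ag z Hz.
have Hpz : H (p%:R * z).
  case: z Hz => x y; rewrite /upper_half_plane natr_complex /= => y0.
  by rewrite mul0r addr0 mulr_gt0 // ltr0n.
have phi_oo N : exists M, forall n, (M <= n)%N -> (N <= (n + p.-1) %/ p)%N.
  exists (N * p)%N => n Nn; rewrite leq_divRL //; exact: leq_trans (leq_addr _ _).
have h := cvgC_comp phi_oo (ag _ Hpz).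
rewrite (_ : series _ = fun n => series (fun k => a k * nome (p%:R * z) ^+ k)
  ((n + p.-1) %/ p)%N); first exact: h.
apply/funext => n; rewrite !seriesEord /=.
transitivity (\sum_(l < n | (p %| l)%N) a (l %/ p)%N * nome z ^+ l).
  by rewrite [RHS]big_mkcond; apply: eq_bigr => l _; case: ifP => // _; rewrite mul0r.
rewrite (sum_dvdn (fun l => a (l %/ p)%N * nome z ^+ l)) //.
by apply: eq_bigr => k _; rewrite mulnK // nome_natl -exprM mulnC.
Qed.

(** The nomes of the [p] points are the [p]-th roots of the nome of [z]; the sum
    of their [k]-th powers vanishes unless [p] divides [k]. *)
Lemma qseries_trace p a g : (0 < p)%N -> qseries a g ->
  qseries (fun l => p%:R * a (p * l)%N)
    (fun z => \sum_(b < p) g ((z + b%:R) / p%:R)).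
Proof.
move=> p0 ag z Hz; have pC : p%:R != 0 :> C by rewrite pnatr_eq0 -lt0n.
have Hb (b : 'I_p) : H ((z + b%:R) / p%:R).
  case: z Hz => x y; rewrite /upper_half_plane !natr_complex -fmorphV /= => y0.
  by rewrite mulr0 add0r addr0 mulr_gt0 // invr_gt0 ltr0n.
have phi_oo N : exists M, forall n, (M <= n)%N -> (N <= p * n)%N.
  by exists N => n Nn; apply: leq_trans Nn _; apply: leq_pmull.
have h := cvgC_sum (fun b : 'I_p => cvgC_comp phi_oo (ag _ (Hb b))).
rewrite (_ : series _ = fun n => \sum_(b < p)
  series (fun k => a k * nome ((z + b%:R) / p%:R) ^+ k) (p * n)%N); first exact: h.
apply/funext => n; rewrite seriesEord /=; under [RHS]eq_bigr do rewrite seriesEord /=.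
rewrite exchange_big /=.
have inner (k : nat) : \sum_(b < p) a k * nome ((z + b%:R) / p%:R) ^+ k
    = if (p %| k)%N then p%:R * a k * nome z ^+ (k %/ p) else 0.
  transitivity (a k * nome (z / p%:R) ^+ k * \sum_(b < p) nome (b%:R / p%:R : C) ^+ k).
    by rewrite mulr_sumr; apply: eq_bigr => b _; rewrite mulrDl nomeD exprMn mulrA.
  rewrite sum_nome_frac //; case: ifP => [pk|]; last by rewrite mulr0.
  have -> : nome (z / p%:R) ^+ k = nome z ^+ (k %/ p).
    by rewrite -{1}(divnK pk) mulnC exprM -nome_natl mulrCA divff ?mulr1.
  by ring.
under [RHS]eq_bigr do rewrite inner.
rewrite -big_mkcond /= (sum_dvdn (fun k => p%:R * a k * nome z ^+ (k %/ p))) //.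
rewrite mulnC divnMDl // divn_small ?prednK // addn0.
by apply: eq_bigr => k _; rewrite mulnK // mulnC.
Qed.

Lemma qseries_hecke p m a f : (0 < p)%N ->
  qseries a (fun z => nome z ^+ m * f z) ->
  qseries (hecke_coef p m a) (fun z => nome z ^+ (p * m) * hecke p f z).
Proof.
move=> p0 af; have pC : p%:R != 0 :> C by rewrite pnatr_eq0 -lt0n.
have h1 := qseries_scale p0 af.
have h2 := qseries_trace p0 (@qseries_shift _ ((p * p - 1) * m) _ _ af).
apply: (qseries_ext (qseriesD h1 h2)) => // z Hz.
rewrite nome_natl -exprM /hecke mulrDr; congr (_ + _).
rewrite mulr_sumr; apply: eq_bigr => b _; rewrite mulrA -exprD.
have -> : ((p * p - 1) * m + m = p * (p * m))%N by nia.
rewrite exprM -nome_natl mulrCA divff // mulr1 nomeD.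
by rewrite -[b%:R]mulr1 nome_natl nome1 expr1n mulr1.
Qed.

End HeckeSeries.

(** * Integrality *)

Section Integrality.
Variable R : realType.
Local Notation C := R[i].
Local Notation H := (@upper_half_plane R).
Implicit Types (f g j : C -> C) (a b u : nat -> C).

Lemma is_integer_int (m : int) : is_integer (m%:~R : C).
Proof. by exists m. Qed.

Lemma is_integerD (x y : C) : is_integer x -> is_integer y -> is_integer (x + y).
Proof. by move=> [m ->] [n ->]; exists (m + n); rewrite rmorphD. Qed.

Lemma is_integerM (x y : C) : is_integer x -> is_integer y -> is_integer (x * y).
Proof. by move=> [m ->] [n ->]; exists (m * n); rewrite rmorphM. Qed.

Lemma is_integerB (x y : C) : is_integer x -> is_integer y -> is_integer (x - y).
Proof. by move=> [m ->] [n ->]; exists (m - n); rewrite rmorphB. Qed.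

Lemma is_integer_sum (n : nat) (F : 'I_n -> C) :
  (forall i, is_integer (F i)) -> is_integer (\sum_i F i).
Proof.
move=> FZ; apply: (big_ind (@is_integer R)) => //; last exact: is_integerD.
exact: (is_integer_int 0).
Qed.

Definition integral_upto (K : nat) a := forall k, (k <= K)%N -> is_integer (a k).

Lemma integral_cauchy_prod K a b :
  integral_upto K a -> integral_upto K b -> integral_upto K (cauchy_prod a b).
Proof.
move=> aZ bZ k kK; apply: is_integer_sum => i.
by apply: is_integerM; [apply: aZ|apply: bZ]; have := ltn_ord i; lia.
Qed.

Lemma integral_cauchy_exp K u n : integral_upto K u -> integral_upto K (cauchy_exp u n).
Proof.
move=> uZ; elim: n => [|n IHn]; last exact: integral_cauchy_prod.
by case=> [|k] _; [exact: (is_integer_int 1)|exact: (is_integer_int 0)].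
Qed.

Lemma cauchy_exp0 u n : u 0%N = 1 -> cauchy_exp u n 0%N = 1.
Proof.
by move=> u0; elim: n => // n IHn; rewrite /= /cauchy_prod big_ord1 u0 mul1r.
Qed.

Lemma cauchy_exp_top u n k : u 0%N = 1 -> integral_upto k u ->
  is_integer (cauchy_exp u n k.+1 - n%:R * u k.+1).
Proof.
move=> u0 uZ; elim: n => [|n IHn].
  by rewrite /= mul0r subr0; exact: (is_integer_int 0).
rewrite /= /cauchy_prod -/(cauchy_exp u n) big_ord_recl big_ord_recr /= subn0 subnn.
rewrite u0 cauchy_exp0 // mul1r mulr1.
set s := \sum_(i < k) _; set v := cauchy_exp u n _ in IHn *.
have -> : v + (s + u k.+1) - n.+1%:R * u k.+1 = s + (v - n%:R * u k.+1).
  by rewrite -natr1; ring.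
apply: is_integerD IHn; apply: is_integer_sum => i; rewrite /bump /=.
have iP := ltn_ord i.
by apply: is_integerM; [apply: uZ|apply: (integral_cauchy_exp n uZ)]; lia.
Qed.

(** An invariant function with integral polar part is a polynomial in j with
    integral coefficients, so that its whole expansion is as integral as that of
    j. The polynomial is found one power of j at a time; what remains in the
    end vanishes at the cusp. *)
Lemma integral_of_polar_part N j u : squarefree N -> integral_invariant N j ->
  qseries u (fun z => nome z * j z) -> u 0%N = 1 ->
  forall (D K : nat) f a, integral_invariant N f ->
    qseries a (fun z => nome z ^+ D * f z) ->
    integral_upto D a -> integral_upto K u -> (D <= K)%N -> integral_upto K a.
Proof.
move=> sqf jinv uj u0; elim=> [|D IHD] K f a finv af aZ uZ DK.
  have h := qseriesD af (@qseries_cst R (- a 0%N)).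
  have f_cst z : H z -> nome z ^+ 0 * f z + cst (- a 0%N) z = 0.
    have [N0 _] := sqf.
    apply: (@qseries_vanish R _ _ (5 * N%:R)^-1 h).
    - by rewrite subrr.
    - by rewrite invr_gt0 mulr_gt0 // ltr0n.
    move=> w Hw; have [b [c [d [d' [e [al le_Im]]]]]] := atkin_lehner_reduction sqf Hw.
    by exists (homography b c d d' w) => //; rewrite !mul1r (finv _ _ _ _ _ _ al Hw).
  move=> [|k] _; first exact: aZ.
  by have := qseries_eq0 h f_cst k.+1; rewrite addr0 => ->; exact: (is_integer_int 0).
have h := qseriesD af (@qseriesZ R (- a 0%N) _ _ (@qseriesX R _ _ D.+1 uj)).
set b := (fun k => _) in h.
have b0 : b 0%N = 0 by rewrite /b cauchy_exp0 // mulr1 subrr.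
have bE k : a k = b k + a 0%N * cauchy_exp u D.+1 k by rewrite /b; ring.
have a0Z : is_integer (a 0%N) by apply: aZ.
have uDZ L : integral_upto L u -> integral_upto L (cauchy_exp u D.+1).
  exact: integral_cauchy_exp.
pose g z : C := f z - a 0%N * j z ^+ D.+1.
have ginv : integral_invariant N g.
  move=> ? ? ? ? ? z al Hz.
  by rewrite /g (finv _ _ _ _ _ _ al Hz) (jinv _ _ _ _ _ _ al Hz).
have bg : qseries (fun k => b k.+1) (fun z => nome z ^+ D * g z).
  apply: (qseries_ext (qseries_behead h)) => // z Hz.
  rewrite b0 subr0 /g; move: (nome z) (nome_neq0 z) => q q0.
  by apply: (mulIf q0); rewrite divfK // exprMn [q ^+ D.+1]exprSr; ring.
have bpolar : integral_upto D (fun k => b k.+1).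
  move=> k kD; rewrite /b mulNr; apply: is_integerB; first exact: aZ.
  by apply: is_integerM a0Z _; apply: (uDZ K uZ); lia.
have bZ := IHD K g _ ginv bg bpolar uZ (ltnW DK).
move=> [|k] kK; first exact: a0Z.
rewrite bE; apply: is_integerD; first by apply: bZ; lia.
by apply: is_integerM a0Z _; apply: (uDZ K).
Qed.

(** The identity between the coefficients of q^n in the Hecke transform of j^m
    and in its expression as an integral polynomial in j: the former contains
    p m times the coefficient of j of index p n + m - 1, the latter involves
    smaller indices only, as soon as n > m. *)
Lemma hecke_integrality N j u p m n : squarefree N -> integral_invariant N j ->
  qseries u (fun z => nome z * j z) -> u 0%N = 1 -> prime p -> coprime p N ->
  (m < n)%N -> integral_upto (p * n + m).-1 u ->
  is_integer ((p * m)%:R * u (p * n + m)%N).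
Proof.
move=> sqf jinv uj u0 pp pN mn uZ; have p1 := prime_gt1 pp.
pose K := (p * n + m).-1; pose a := cauchy_exp u m.
have KE : (p * n + m = K.+1)%N by rewrite prednK //; nia.
have aZ : integral_upto K a by apply: integral_cauchy_exp.
have af : qseries a (fun z => nome z ^+ m * j z ^+ m).
  by apply: (qseries_ext (@qseriesX R _ _ m uj)) => // z _; rewrite exprMn.
have hf := qseries_hecke (ltnW p1) af.
have hinv : integral_invariant N (hecke p (fun z => j z ^+ m)).
  apply: hecke_invariant => // b c d d' e z al Hz.
  by rewrite (jinv _ _ _ _ _ _ al Hz).
have shiftZ l : (p * l - (p * p - 1) * m <= K)%N ->
    is_integer (shift_coef ((p * p - 1) * m) a (p * l)%N).
  rewrite /shift_coef; case: ifP => _ lK; first exact: (is_integer_int 0).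
  exact: aZ.
have divZ l : (l %/ p <= K)%N ->
    is_integer (if (p %| l)%N then a (l %/ p)%N else 0).
  by move=> lK; case: ifP => _; [exact: aZ|exact: (is_integer_int 0)].
have polarZ : integral_upto (p * m) (hecke_coef p m a).
  move=> l lpm; apply: is_integerD.
    by apply: divZ; apply: leq_trans (leq_div2r p lpm) _; rewrite mulKn; nia.
  by apply: is_integerM (is_integer_int p) _; apply: shiftZ; nia.
have hZ : is_integer (hecke_coef p m a (p * m + n)).
  apply: (integral_of_polar_part sqf jinv uj u0 hinv hf polarZ uZ); nia.
have divnZ : is_integer (if (p %| p * m + n)%N then a ((p * m + n) %/ p)%N else 0).
  apply: divZ; have := leq_div n p; rewrite mulnC divnMDl ?(ltnW p1) //; nia.
have := is_integerB hZ divnZ; rewrite addrAC subrr add0r.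
have -> : shift_coef ((p * p - 1) * m) a (p * (p * m + n)) = a K.+1.
  by rewrite /shift_coef ifN; [congr a|]; nia.
move=> paZ.
have := is_integerB paZ (is_integerM (is_integer_int p) (cauchy_exp_top m u0 uZ)).
by rewrite -/K -KE -/a; congr is_integer; rewrite KE natrM; ring.
Qed.

Lemma is_integer_coprime (x : C) (r s : nat) : coprime r s ->
  is_integer (r%:R * x) -> is_integer (s%:R * x) -> is_integer x.
Proof.
move=> rs rx sx; have /coprimezP[[v w] /= vw] : coprimez r s by [].
have -> : x = v%:~R * (r%:R * x) + w%:~R * (s%:R * x).
  rewrite !mulrA -mulrDl -[r%:R]/(r%:Z%:~R) -[s%:R]/(s%:Z%:~R) -!rmorphM -rmorphD.
  by rewrite vw mul1r.
by apply: is_integerD; apply: is_integerM => //; apply: is_integer_int.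
Qed.

(** [hecke_integrality] applies to two values [m] and [m + p] congruent to [k + 1]
    modulo [p], and the factors [p m] and [p (m + p)] differ by [p * p]. The bound
    on [k] leaves room for [n > m] in both cases. *)
Lemma hecke_integrality_square N j u p k : squarefree N -> integral_invariant N j ->
  qseries u (fun z => nome z * j z) -> u 0%N = 1 -> prime p -> coprime p N ->
  (4 * p ^ 2 <= k)%N -> integral_upto k u -> is_integer ((p * p)%:R * u k.+1).
Proof.
move=> sqf jinv uj u0 pp pN pk uZ; have p1 := prime_gt1 pp.
have kE := divn_eq k p; have r_lt : (k %% p < p)%N by rewrite ltn_mod ltnW.
set q := (k %/ p)%N in kE; set r := (k %% p)%N in kE r_lt.
have q_ge : (2 * p + 2 <= q)%N by rewrite leq_divRL ?(ltnW p1) //; nia.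
have h1 : is_integer ((p * r.+1)%:R * u k.+1).
  have -> : k.+1 = (p * q + r.+1)%N by lia.
  apply: (hecke_integrality sqf jinv uj u0 pp pN); first lia.
  by have -> : (p * q + r.+1).-1 = k by lia.
have h2 : is_integer ((p * (r.+1 + p))%:R * u k.+1).
  have -> : k.+1 = (p * q.-1 + (r.+1 + p))%N by nia.
  apply: (hecke_integrality sqf jinv uj u0 pp pN); first lia.
  by have -> : (p * q.-1 + (r.+1 + p)).-1 = k by nia.
have := is_integerB h2 h1; congr is_integer.
by rewrite -mulrBl -natrB; [congr (_%:R * _)|]; nia.
Qed.

End Integrality.

Theorem theorem4 (R : realType) (N : nat) (hN : squarefree N)
    (hgenus : genus_zero R N)
    (j : R[i] -> R[i]) (hj : is_hauptmodul N j)
    (c : nat -> R[i]) (hc : normalized_q_expansion j c)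
    (p1 p2 : nat) (hp1 : prime p1) (hp2 : prime p2) (hp12 : (p1 < p2)%N)
    (hp1N : coprime p1 N) (hp2N : coprime p2 N)
    (kappa : nat)
    (hkappa : p2%:R / (p2%:R - 1) * (p1 * p2)%:R ^+ 2 <= kappa%:R :> rat)
    (hint : forall k : nat, (k <= kappa)%N -> is_integer (c k)) :
  forall k : nat, is_integer (c k).
Proof.
have [/invariant_under_integral jinv _ _ _] := hj.
pose u (k : nat) : R[i] := if k is k'.+1 then c k' else 1.
have uj : qseries u (fun z => nome z * j z).
  apply: (qseries_ext (@qseries_cons R 1 _ _ hc)) => // z _.
  by rewrite mulrBr divff ?nome_neq0 // addrC subrK.
have kappa_ge : ((p1 * p2) ^ 2 <= kappa)%N.
  rewrite -(ler_nat rat) natrX; apply: le_trans hkappa.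
  have p2_gt1 : 1 < p2%:R :> rat by rewrite ltr1n prime_gt1.
  rewrite ler_peMl ?sqr_ge0 // ler_pdivlMr ?subr_gt0 //; lra.
have [g1 g2] := (prime_gt1 hp1, prime_gt1 hp2).
elim/ltn_ind => k IHk; have [/hint//|kappa_lt] := leqP k kappa.
have uZ : integral_upto k u.
  by case=> [|i] ik; [exact: (is_integer_int R 1)|exact: IHk].
have step p : prime p -> coprime p N -> (4 * p ^ 2 <= kappa)%N ->
    is_integer ((p * p)%:R * c k).
  move=> pp pN pk.
  apply: (hecke_integrality_square hN jinv uj (erefl : u 0%N = 1) pp pN _ uZ).
  exact: leq_trans pk (ltnW kappa_lt).
apply: (@is_integer_coprime R (c k) (p1 * p1) (p2 * p2)).
- rewrite coprimeMl !coprimeMr andbb andbb prime_coprime // dvdn_prime2 //.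
  by rewrite ltn_eqF.
- apply: step => //; apply: leq_trans kappa_ge.
  by rewrite -[4%N]/(2 ^ 2)%N -expnMn leq_sqr; nia.
- apply: step => //; apply: leq_trans kappa_ge.
  by rewrite -[4%N]/(2 ^ 2)%N -expnMn leq_sqr; nia.
Qed.
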